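(* The Poisson primitive ideals of $A$ are exactly: the Poisson maximal ideals of $A$, and the proper Poisson ideals of $A$ that are minimal prime ideals of some proper ideal $f^1_{\lambda_1,\mu_1}A+\dots+f^{n-2}_{\lambda_{n-2},\mu_{n-2}}A$ with $(\lambda_i,\mu_i)\in\mathbb{C}^2\setminus\{(0,0)\}$ for all $i$. Moreover $A$ satisfies the Poisson Dixmier–Moeglin equivalence: for a Poisson prime ideal $P$ of $A$, the conditions ''$P$ is locally closed'', ''$P$ is Poisson primitive'' and ''$P$ is rational'' are equivalent.
   Context: Let $n\ge 3$, $A=\mathbb{C}[x_1,\dots,x_n]$. Fix $s_1,t_1,\dots,s_{n-2},t_{n-2}\in A$ with each $t_i\ne 0$ and $s_i,t_i$ coprime, such that $s_1/t_1,\dots,s_{n-2}/t_{n-2}$ are algebraically independent over $\mathbb{C}$. $A$ carries the Poisson bracket $\{f,g\}=(t_1\cdots t_{n-2})^2\,\mathrm{Jac}(f,g,s_1/t_1,\dots,s_{n-2}/t_{n-2})$ ($\mathrm{Jac}$ = Jacobian determinant with respect to $x_1,\dots,x_n$). For $(\lambda_i,\mu_i)\in\mathbb{C}^2\setminus\{(0,0)\}$, $f^i_{\lambda_i,\mu_i}=\lambda_is_i-\mu_it_i$. A Poisson ideal is an ideal $I$ with $\{I,A\}\subseteq I$; a Poisson prime (resp. Poisson maximal) ideal is a prime (resp. maximal) ideal that is Poisson. A Poisson ideal $I$ is residually null if the induced bracket on $A/I$ is zero, and proper otherwise. The Poisson core $\mathcal{P}(J)$ of an ideal $J$ is the largest Poisson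 ideal contained in $J$; a Poisson ideal is Poisson primitive if it equals $\mathcal{P}(M)$ for a maximal ideal $M$. A Poisson prime $P$ is locally closed if the intersection of all Poisson primes strictly containing $P$ strictly contains $P$, and rational if the Poisson centre $\{z\in Q(A/P):\{z,r\}=0\ \forall r\}$ of the fraction field $Q(A/P)$ (with the induced bracket) equals $\mathbb{C}$. *)

(* Defs.v *)
From mathcomp Require Import all_boot all_algebra.
From mathcomp Require Import Rstruct.
From mathcomp.real_closed Require Import complex.
From mathcomp Require Import mpoly.
Set Implicit Arguments. Unset Strict Implicit. Unset Printing Implicit Defensive.
Import GRing.Theory.
Local Open Scope ring_scope.

Notation CC := (complex Rdefinitions.R).

Section Ideals.
Variable R : comUnitRingType.
Implicit Types (I J : R -> Prop).

Definition subsetP I J := forall x, I x -> J x.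
Definition ssubsetP I J := subsetP I J /\ exists x, J x /\ ~ I x.

Definition ideal I :=
  I 0 /\ (forall a b, I a -> I b -> I (a + b)) /\ (forall r a, I a -> I (r * a)).

Definition prime_ideal I :=
  ideal I /\ ~ I 1 /\ (forall a b, I (a * b) -> I a \/ I b).

Definition maximal_ideal I :=
  ideal I /\ ~ I 1 /\
  (forall J, ideal J -> subsetP I J -> subsetP J I \/ J 1).

Definition minimal_prime I J :=
  prime_ideal I /\ subsetP J I /\
  (forall Q, prime_ideal Q -> subsetP J Q -> subsetP Q I -> subsetP I Q).

Definition gen_ideal k (f : 'I_k -> R) : R -> Prop :=
  fun x => exists a : 'I_k -> R, x = \sum_(i < k) f i * a i.

Definition coprimeR (a b : R) :=
  forall d, (exists u, a = d * u) -> (exists v, b = d * v) -> d \is a GRing.unit.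

Variable br : R -> R -> R.

Definition poisson_ideal I := ideal I /\ (forall a r, I a -> I (br a r)).
Definition poisson_prime I := poisson_ideal I /\ prime_ideal I.
Definition poisson_maximal I := poisson_ideal I /\ maximal_ideal I.
Definition residually_null I := forall a b, I (br a b).
(* "proper" Poisson ideal in the paper's sense: not residually null *)
Definition proper_poisson I := poisson_ideal I /\ ~ residually_null I.

Definition is_poisson_core J I :=
  poisson_ideal I /\ subsetP I J /\
  (forall I', poisson_ideal I' -> subsetP I' J -> subsetP I' I).

Definition poisson_primitive I :=
  exists M, maximal_ideal M /\ is_poisson_core M I.

(* the intersection of all Poisson primes strictly containing P
   strictly contains P *)
Definition locally_closed P :=
  exists a, ~ P a /\ (forall Q, poisson_prime Q -> ssubsetP P Q -> Q a).

End Ideals.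

Section PolyRing.
Variable n : nat.
Local Notation A := {mpoly CC[n]}.

Definition alg_indep_fracs (s t : 'I_(n - 2) -> A) :=
  forall p : {mpoly CC[n - 2]}, p != 0 ->
    mmap (fun c : CC => tofrac (c%:MP : A))
         (fun i => tofrac (s i) / tofrac (t i)) p != 0.

(* {f,g} = (t_1...t_{n-2})^2 Jac(f, g, s_1/t_1, ..., s_{n-2}/t_{n-2}).
   By the quotient rule d(s/t) = (t ds - s dt)/t^2 and multilinearity of the
   determinant in its rows, this equals the determinant of the n x n matrix
   with rows  df, dg, t_i ds_i - s_i dt_i  (i = 1..n-2). *)
Definition jac_row (s t : 'I_(n - 2) -> A) (k : nat) (j : 'I_n) : A :=
  match (insub (k - 2)%N : option 'I_(n - 2)) with
  | Some i => t i * (s i)^`M(j) - s i * (t i)^`M(j)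
  | None => 0
  end.

Definition pbracket (s t : 'I_(n - 2) -> A) (f g : A) : A :=
  \det (\matrix_(k < n, j < n)
          (if val k == 0%N then f^`M(j)
           else if val k == 1%N then g^`M(j)
           else jac_row s t (val k) j)).

(* rationality of a Poisson prime P: the Poisson centre of Q(A/P) is C.
   An element of Q(A/P) is a class a/b with b notin P; it is Poisson central
   iff {a,r} b - a {b,r} in P for all r in A, and it lies in C iff
   a - c b in P for some c in C. *)
Definition rational_pp (br : A -> A -> A) (P : A -> Prop) :=
  forall a b : A, ~ P b ->
    (forall r : A, P (br a r * b - a * br b r)) ->
    exists c : CC, P (a - c *: b).

End PolyRing.

(* Main.v *)
(* Write [A] for the polynomial ring.  The functions s_i/t_i are Casimirs of
   the bracket, so modulo a rational Poisson prime P each of them is constant,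
   i.e. P contains a member of every pencil (f^i).

   If moreover some {a, b} is not in P, no prime Q with (f) <= Q < P exists.
   Pick h in P \ Q.  Applying {a, -} and {-, b} shows that a, b are
   algebraically independent modulo P, hence a, b, h are so modulo Q, and there
   is a derivation of A into Frac(A/Q) that kills Q, a and b but not h.  Its
   coefficient vector is annihilated by the matrix whose determinant is {a, b},
   which is nonzero modulo Q: a contradiction.  So P is minimal over (f), and
   the same applies to every Poisson prime above P that avoids {a, b}; thus
   {a, b} witnesses that P is locally closed.  Residually null primes satisfy
   one of the three conditions iff they are maximal.

   Locally closed => primitive uses the Nullstellensatz (obtained here from the
   uncountability of C) and the primality of Poisson cores; for primitive =>
   rational, the denominators of a Poisson-central fraction form a Poisson
   ideal, so the fraction can be evaluated at the maximal ideal. *)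
From HB Require Import structures.
From mathcomp Require Import all_boot all_algebra.
From mathcomp Require Import boolp classical_sets functions cardinality.
From mathcomp Require Import Rstruct.
From mathcomp.real_closed Require Import complex.
From mathcomp Require Import perm mpoly ring.
From Stdlib Require Runcountable.
Require Import Defs.
Set Implicit Arguments. Unset Strict Implicit. Unset Printing Implicit Defensive.
Import GRing.Theory.
Local Open Scope ring_scope.

(** * Uncountability of C as a covering principle *)

Section Uncountability.
Local Open Scope classical_set_scope.

(** Otherwise the real line would be a countable union of finite sets, hence countable. *)
Lemma countable_cover_infinite (I : countType) (E : I -> set CC) :
  (forall c, exists k, E k c) -> exists k, infinite_set (E k).
Proof.
move=> cov; apply: contrapT => /forallNP fin.
pose F k := [set x : Rdefinitions.R | E k (x%:C)%C].
have finF k : finite_set (F k).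
  have /contrapT finE := fin k.
  apply: (@finite_preimage _ _ (E k) (fun x : Rdefinitions.R => (x%:C)%C)) => //.
  by move=> x y _ _ [].
have covF : [set: Rdefinitions.R] = \bigcup_k F k.
  by apply/seteqP; split=> // x _; have [k Ek] := cov (x%:C)%C; exists k.
have cntR : countable [set: Rdefinitions.R].
  rewrite covF; apply: bigcup_countable => // k _.
  exact: finite_set_countable.
(* Being infinite turns countability into a bijection with [nat]. *)
have infR : ~ finite_set [set: Rdefinitions.R].
  move=> finR; apply: infinite_nat.
  have inj : {in [set: nat] &, injective (fun k : nat => k%:R : Rdefinitions.R)}.
    by move=> j k _ _ /eqP; rewrite Num.Theory.eqr_nat => /eqP.
  by rewrite -(eq_finite_set (inj_card_eq inj)); apply: sub_finite_set finR.
have /card_set_bijP[f] := eq_card_nat cntR infR.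
rewrite setTT_bijective => -[g fg gf].
by apply: (@Runcountable.R_uncountable g); exists f.
Qed.
End Uncountability.

(** * Ideals and derivations *)

Section IdealTheory.
Variables (R : comUnitRingType) (I : R -> Prop).
Hypothesis idI : ideal I.

Lemma ideal0 : I 0. Proof. by case: idI. Qed.

Lemma idealD a b : I a -> I b -> I (a + b).
Proof. by case: idI => _ [+ _]; apply. Qed.

Lemma idealMl r a : I a -> I (r * a).
Proof. by case: idI => _ [_]; apply. Qed.

Lemma idealMr r a : I a -> I (a * r).
Proof. by rewrite mulrC; apply: idealMl. Qed.

Lemma idealN a : I a -> I (- a).
Proof. by rewrite -mulN1r; apply: idealMl. Qed.

Lemma idealB a b : I a -> I b -> I (a - b).
Proof. by move=> Ia Ib; exact/idealD/idealN. Qed.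

Lemma ideal_sum J (r : seq J) (Q : pred J) (F : J -> R) :
  (forall i, Q i -> I (F i)) -> I (\sum_(i <- r | Q i) F i).
Proof. by move=> IF; elim/big_rec: _ => [|i x Qi]; [exact: ideal0|exact/idealD/IF]. Qed.

Lemma idealMn a k : I a -> I (a *+ k).
Proof. by move=> Ia; rewrite -mulr_natl; apply: idealMl. Qed.

Lemma ideal_congl a b : I (a - b) -> I b -> I a.
Proof. by move=> Iab Ib; rewrite -(subrK b a); apply: idealD. Qed.

Lemma ideal_congr a b : I (a - b) -> I a -> I b.
Proof. by move=> Iab Ia; rewrite -(subKr a b); apply: idealB. Qed.

Lemma idealMn_unit k a :
  (k.+1%:R : R) \is a GRing.unit -> I (a *+ k.+1) -> I a.
Proof. by move=> kU /(idealMl k.+1%:R^-1); rewrite -[a *+ _]mulr_natl mulrA mulVr ?mul1r. Qed.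

Lemma ideal_expW x i j : (i <= j)%N -> I (x ^+ i) -> I (x ^+ j).
Proof. by move=> leij /(idealMl (x ^+ (j - i))); rewrite -exprD subnK. Qed.

Lemma ideal_expD x y i j :
  I (x ^+ i) -> I (y ^+ j) -> I ((x + y) ^+ (i + j)).
Proof.
move=> Ix Iy; rewrite exprDn; apply: ideal_sum => k _; apply: idealMn.
have [jk|kj] := leqP j k; first by apply/idealMl/(ideal_expW jk).
by apply/idealMr/(@ideal_expW _ i) => //; rewrite -addnBA ?leq_addr // ltnW.
Qed.

End IdealTheory.

Section PrimeIdealTheory.
Variables (R : comUnitRingType) (P : R -> Prop).
Hypothesis prP : prime_ideal P.

Lemma prime_ideal_ideal : ideal P. Proof. by case: prP. Qed.

Lemma prime_ideal_mem a b : P (a * b) -> ~ P a -> P b.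
Proof. by case: prP => _ [_ H] /H[]. Qed.

Lemma prime_idealM a b : ~ P a -> ~ P b -> ~ P (a * b).
Proof. by move=> Pa Pb /prime_ideal_mem /(_ Pa). Qed.

Lemma prime_idealX a k : ~ P a -> ~ P (a ^+ k).
Proof.
move=> Pa; elim: k => [|k IHk]; first by rewrite expr0; case: prP => _ [H _].
by rewrite exprS; apply: prime_idealM.
Qed.

Lemma prime_ideal_prod J (r : seq J) (F : J -> R) :
  P (\prod_(i <- r) F i) -> exists i, P (F i).
Proof.
elim: r => [|i r IHr]; first by rewrite big_nil; case: prP => _ [].
by rewrite big_cons; case: prP => _ [_ H] /H[Pi|/IHr//]; exists i.
Qed.

End PrimeIdealTheory.

Lemma maximal_ideal_prime (R : comUnitRingType) (M : R -> Prop) :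
  maximal_ideal M -> prime_ideal M.
Proof.
case=> idM [M1 maxM]; split=> //; split=> // a b Mab.
have [Ma|Ma] := pselect (M a); [by left|right].
pose J x := exists2 m, M m & exists r, x = m + r * a.
have MJ x : M x -> J x by exists x => //; exists 0; rewrite mul0r addr0.
have idJ : ideal J.
  split; first exact/MJ/(ideal0 idM).
  split=> [x y [m Mm [r ->]] [m' Mm' [r' ->]]|r x [m Mm [r' ->]]].
    by exists (m + m'); [exact: idealD|exists (r + r'); ring].
  by exists (r * m); [exact: idealMl|exists (r * r'); ring].
have [JM|[m Mm [r E]]] := maxM J idJ MJ.
  by case: Ma; apply: JM; exists 0; [exact: ideal0|exists 1; rewrite mul1r add0r].
have -> : b = b * m + r * (a * b) by rewrite -[LHS]mul1r E; ring.
by apply: idealD => //; apply: idealMl.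
Qed.

Definition derivation (R : comUnitRingType) (d : R -> R) :=
  (forall a b, d (a + b) = d a + d b) /\
  (forall a b, d (a * b) = a * d b + d a * b).

Section Derivations.
Variables (R : comUnitRingType) (d : R -> R).
Hypothesis derd : derivation d.

Lemma derivationD a b : d (a + b) = d a + d b. Proof. by case: derd. Qed.

Lemma derivationM a b : d (a * b) = a * d b + d a * b.
Proof. by case: derd. Qed.

Lemma derivation1 : d 1 = 0.
Proof.
by have := derivationM 1 1; rewrite !mul1r mulr1 -[LHS]addr0 => /addrI.
Qed.

Lemma derivation0 : d 0 = 0.
Proof. by have := derivationD 0 0; rewrite addr0 -[LHS]addr0 => /addrI. Qed.

Lemma derivationN a : d (- a) = - d a.
Proof.
by apply/eqP; rewrite -addr_eq0 addrC -derivationD subrr derivation0.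
Qed.

Lemma derivationB a b : d (a - b) = d a - d b.
Proof. by rewrite derivationD derivationN. Qed.

Lemma derivationXS x k : d (x ^+ k.+1) = (x ^+ k * d x) *+ k.+1.
Proof.
elim: k => [|k IHk]; first by rewrite !expr1 expr0 mul1r.
by rewrite exprS derivationM IHk -mulrnAr mulrA -exprS [d x * _]mulrC mulrnAr -mulrSr.
Qed.

Lemma derivationX x k : d (x ^+ k) * x = (x ^+ k * d x) *+ k.
Proof.
case: k => [|k]; first by rewrite expr0 derivation1 mul0r mulr0n.
by rewrite derivationXS mulrnAl mulrAC -exprSr.
Qed.

(** Repeated differentiation of x^m trades each factor x for (d x)^2: by induction I contains
    x^(m-k) (d x)^(2k), and k = m is the claim. *)
Lemma derivation_ideal_radical (I : R -> Prop) :
  (forall k, (k.+1%:R : R) \is a GRing.unit) -> ideal I ->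
  (forall a, I a -> I (d a)) ->
  forall x m, I (x ^+ m) -> I (d x ^+ m.*2).
Proof.
move=> char0 idI Id x m Ixm.
suff H k : (k <= m)%N -> I (x ^+ (m - k) * d x ^+ k.*2).
  by have := H m (leqnn m); rewrite subnn mul1r.
elim: k => [|k IHk] ltkm; first by rewrite subn0 mulr1.
have {IHk} := IHk (ltnW ltkm); rewrite -(subnSK ltkm).
set j := (m - k.+1)%N; set y := d x => Iy.
apply: (@idealMn_unit _ _ idI j) => //.
(* The extra factor y makes the derivative of y^(2k) a multiple of y^(2k), so the first summand lies
   in I; the integer j + 1 in the second is a unit. *)
have E : d (x ^+ j.+1 * y ^+ k.*2) * y =
    (x ^+ j.+1 * y ^+ k.*2 * d y) *+ k.*2 + (x ^+ j * y ^+ k.+1.*2) *+ j.+1.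
  rewrite derivationM derivationXS mulrDl -mulrA derivationX mulrnAr mulrA.
  by rewrite !mulrnAl doubleS !exprSr !mulrA -/y [x ^+ j * y * _]mulrAC.
apply: (ideal_congl idI (b := d (x ^+ j.+1 * y ^+ k.*2) * y)).
  by rewrite E opprD addrCA subrr addr0; exact/(idealN idI)/(idealMn idI)/(idealMr idI).
by apply: idealMr => //; apply: Id.
Qed.

End Derivations.

(** * Poisson cores *)

Section PoissonCore.
Variables (R : comUnitRingType) (br : R -> R -> R).
Hypothesis char0 : forall k, (k.+1%:R : R) \is a GRing.unit.
Hypothesis brD : forall r, derivation (br^~ r).

(** The union of the Poisson ideals inside [M]; for an ideal [M] it is an ideal, since a sum of two
    of them is another one. *)
Definition poisson_core (M : R -> Prop) x :=
  exists I, [/\ poisson_ideal br I, subsetP I M & I x].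

Lemma poisson_core_sub M : subsetP (poisson_core M) M.
Proof. by move=> x [I [_ + Ix]]; apply. Qed.

Lemma poisson_core_ideal M : ideal M -> poisson_ideal br (poisson_core M).
Proof.
move=> idM; split; last first.
  by move=> a r [I [pI IM Ia]]; exists I; split=> //; case: pI => _; apply.
split; first by exists (eq^~ 0); split=> // [|_ ->]; last exact: ideal0;
  split=> [|_ r ->]; [split=> //; split=> [_ _ -> ->|r _ ->];
  rewrite ?addr0 ?mulr0|exact: derivation0 (brD r)].
split=> [a b [I [pI IM Ia]] [J [pJ JM Jb]]|r a [I [pI IM Ia]]]; last first.
  by exists I; split=> //; apply: idealMl => //; case: pI.
have [[idI brI] [idJ brJ]] := (pI, pJ).
exists (fun x => exists2 u, I u & exists2 v, J v & x = u + v).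
split; last by exists a => //; exists b.
- split; last first.
    move=> _ r [u Iu [v Jv ->]]; exists (br u r); first exact: brI.
    by exists (br v r); [exact: brJ|rewrite (derivationD (brD r))].
  split; first by exists 0; [|exists 0; rewrite ?addr0]; try exact: ideal0.
  split=> [_ _ [u Iu [v Jv ->]] [u' Iu' [v' Jv' ->]]|r _ [u Iu [v Jv ->]]].
    exists (u + u'); first exact: idealD.
    by exists (v + v'); [exact: idealD|rewrite addrACA].
  exists (r * u); first exact: idealMl.
  by exists (r * v); [exact: idealMl|rewrite mulrDr].
- by move=> _ [u Iu [v Jv ->]]; apply: idealD => //; [exact: IM|exact: JM].
Qed.

Lemma poisson_core_max M I :
  poisson_ideal br I -> subsetP I M -> subsetP I (poisson_core M).
Proof. by move=> pI IM x Ix; exists I. Qed.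

Lemma poisson_ideal_radical I :
  poisson_ideal br I -> poisson_ideal br (fun x => exists m, I (x ^+ m)).
Proof.
case=> idI brI; split; last first.
  move=> a r [m Iam]; exists m.*2.
  by apply: (derivation_ideal_radical (brD r)) => // ? ?; apply: brI.
split; first by exists 1; rewrite expr1; apply: ideal0.
split=> [a b [i Ia] [j Ib]|r a [m Ia]].
  by exists (i + j)%N; apply: ideal_expD.
by exists m; rewrite exprMn; apply: idealMl.
Qed.

Lemma poisson_ideal_colon I a :
  poisson_ideal br I -> (forall x m, I (x ^+ m) -> I x) ->
  poisson_ideal br (fun x => I (a * x)).
Proof.
case=> idI brI radI; split.
  split; first by rewrite mulr0; apply: ideal0.
  split=> [x y Ix Iy|r x Ix]; first by rewrite mulrDr; apply: idealD.
  by rewrite mulrCA; apply: idealMl.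
move=> x r Ix; apply: (radI _ 2%N).
(* The square is a combination of [br (a * x) r] and [a * x], both in [I]; the radical hypothesis
   then removes the square. *)
have -> : (a * br x r) ^+ 2 =
    (a * br x r) * br (a * x) r - (br a r * br x r) * (a * x).
  by rewrite (derivationM (brD r)); ring.
by apply: idealB => //; apply: idealMl => //; apply: brI.
Qed.

(* Radicals of Poisson ideals, and colons [(I : a)] of radical Poisson ideals,
   are again Poisson ideals; inside the prime [M] they fall into the core. *)
Lemma poisson_core_prime M : prime_ideal M -> prime_ideal (poisson_core M).
Proof.
move=> prM; have idM := prime_ideal_ideal prM.
have pC := poisson_core_ideal idM; have [idC _] := pC.
have radC x m : poisson_core M (x ^+ m) -> poisson_core M x.
  move=> Cx; apply: (poisson_core_max (poisson_ideal_radical pC)).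
    move=> y [k] /(@poisson_core_sub M) Myk; apply: contrapT => My.
    by move: Myk; apply: prime_idealX.
  by exists m.
split=> //; split.
  by move/(@poisson_core_sub M); case: prM => _ [].
have step a b : poisson_core M (a * b) -> ~ M a -> poisson_core M b.
  move=> Cab Ma; apply: (poisson_core_max (poisson_ideal_colon a pC radC)) => //.
  by move=> x /(@poisson_core_sub M) /(prime_ideal_mem prM); apply.
move=> a b Cab.
(* Either the colon ideal of [a] lies in [M], hence in the core, or it has an element [c] outside
   [M], and [step] for [c] puts [a] in the core. *)
have [sub|] := pselect (subsetP (fun x => poisson_core M (a * x)) M).
  by right; apply: (poisson_core_max (poisson_ideal_colon a pC radC)).
move=> /existsNP[c /not_implyP[Cac Mc]].
by left; apply: (step c) => //; rewrite mulrC.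
Qed.

Lemma poisson_core_is_core M : ideal M -> is_poisson_core br M (poisson_core M).
Proof.
move=> idM; split; first exact: poisson_core_ideal.
by split=> [|I pI IM]; [exact: poisson_core_sub|exact: poisson_core_max].
Qed.

Lemma is_poisson_core_eq M I :
  ideal M -> is_poisson_core br M I -> I = poisson_core M.
Proof.
move=> idM [pI [IM maxI]]; apply/funext => x; apply/propext; split.
  exact: poisson_core_max.
by apply: maxI; [exact: poisson_core_ideal|exact: poisson_core_sub].
Qed.

Lemma poisson_primitive_prime P :
  poisson_primitive br P -> poisson_prime br P.
Proof.
case=> M [maxM coreP]; have prM := maximal_ideal_prime maxM.
have idM := prime_ideal_ideal prM.
rewrite (is_poisson_core_eq idM coreP).
by split; [exact: poisson_core_ideal|exact: poisson_core_prime].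
Qed.

Lemma poisson_maximal_primitive P :
  poisson_maximal br P -> poisson_primitive br P.
Proof. by case=> pP maxP; exists P; split=> //; split=> //; split. Qed.

(** Since [P] contains all brackets, the maximal ideal [M] above it is Poisson and equals its own
    core. *)
Lemma residually_null_primitive P :
  residually_null br P -> poisson_primitive br P -> poisson_maximal br P.
Proof.
move=> nullP [M [maxM [[idP brP] [PM maxP]]]].
have idM : ideal M by case: maxM.
have pM : poisson_ideal br M by split=> // a r _; apply: PM; apply: nullP.
suff eqPM : P = M by split=> //; rewrite eqPM.
by apply/funext => x; apply/propext; split; [exact: PM|exact: maxP].
Qed.

End PoissonCore.

(** * The Nullstellensatz over C *)

Section AvoidingIdeals.
Variables (R : comUnitRingType) (P : R -> Prop) (a : R).
Hypotheses (idP : ideal P) (Pa : forall k, ~ P (a ^+ k)).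

(** Zorn for the ideals over [P] that miss every power of [a]. Adding some [u] outside [N] must
    capture a power of [a], so [u] becomes invertible in (R/N)[1/a]. *)
Lemma maximal_avoiding_ideal :
  exists N, [/\ ideal N, subsetP P N, forall k, ~ N (a ^+ k) &
    forall u, ~ N u -> exists k r, N (a ^+ k - r * u)].
Proof.
pose good (X : set R) := [/\ ideal X, subsetP P X & forall k, ~ X (a ^+ k)].
pose pred X := X = set0%classic \/ good X.
have [F FP totF|N [[N0|[idN PN Na]] maxN]] := @Zorn_bigcup R pred.
- have [[X0 [FX0 [idX0 PX0 X0a]]]|none] :=
    pselect (exists X, F X /\ good X); last first.
    left; apply/seteqP; split=> // x [X FX Xx].
    have [XE|gX] := FP _ FX; first by move: Xx; rewrite XE.
    by case: none; exists X.
  have goodX X x : F X -> X x -> good X.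
    by move=> FX Xx; have [XE|//] := FP _ FX; move: Xx; rewrite XE.
  right; split.
  + split; first by exists X0 => //; apply: ideal0.
    split=> [x y [X FX Xx] [Y FY Yy]|r x [X FX Xx]]; last first.
      by exists X => //; apply: idealMl => //; case: (goodX _ _ FX Xx).
    have [XY|YX] := totF _ _ FX FY.
      by exists Y => //; apply: (idealD _ (XY _ Xx) Yy); case: (goodX _ _ FY Yy).
    by exists X => //; apply: (idealD _ Xx (YX _ Yy)); case: (goodX _ _ FX Xx).
  + by move=> x Px; exists X0 => //; apply: PX0.
  + by move=> k [X FX Xk]; have [_ _ /(_ k)] := goodX _ _ FX Xk; apply.
- case: (maxN P); last by right; split.
  by rewrite N0; split=> // /(_ 0 (ideal0 idP)).
exists N; split=> // u Nu; apply: contrapT => none.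
pose J x := exists2 m, N m & exists r, x = m + r * u.
have NJ : subsetP N J.
  by move=> x Nx; exists x => //; exists 0; rewrite mul0r addr0.
case: (maxN J).
  split=> // JN; apply/Nu/JN.
  by exists 0; [exact: ideal0|exists 1; rewrite mul1r add0r].
right; split.
- split; first exact/NJ/(ideal0 idN).
  split=> [x y [m Nm [r ->]] [m' Nm' [r' ->]]|r x [m Nm [r' ->]]].
    by exists (m + m'); [exact: idealD|exists (r + r'); ring].
  by exists (r * m); [exact: idealMl|exists (r * r'); ring].
- by move=> x /PN; apply: NJ.
- by move=> k [m Nm [r E]]; apply: none; exists k, r; rewrite E addrK.
Qed.

Lemma prime_avoiding_ideal :
  exists N, [/\ prime_ideal N, subsetP P N, ~ N a &
    forall u, ~ N u -> exists k r, N (a ^+ k - r * u)].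
Proof.
have [N [idN PN Na maxN]] := maximal_avoiding_ideal.
exists N; split=> //; last exact: (Na 1%N).
split=> //; split; first exact: (Na 0%N).
move=> x y Nxy; apply: contrapT => /not_orP[/maxN[i [r Nr]] /maxN[j [q Nq]]].
apply: (Na (i + j)%N).
have -> : a ^+ (i + j) =
    a ^+ j * (a ^+ i - r * x) + r * x * (a ^+ j - q * y) + r * q * (x * y).
  by rewrite exprD; ring.
by apply: idealD => //; [apply: idealD => //|]; apply: idealMl.
Qed.

End AvoidingIdeals.

(** Only monomials of degree below [d] occur, so the coefficient matrix has more rows than columns
    and a nonzero left kernel. *)
Lemma mpoly_linear_dependence (K : fieldType) (n d m : nat)
    (g : 'I_m -> {mpoly K[n]}) :
  (forall i, msize (g i) <= d)%N -> (#|{: 'X_{1..n < d}}| < m)%N ->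
  exists beta : 'I_m -> K,
    (exists i, beta i != 0) /\ \sum_i beta i *: g i = 0.
Proof.
move=> gd ltm.
pose M := \matrix_(i < m, j < #|{: 'X_{1..n < d}}|) (g i)@_(enum_val j).
have : kermx M != 0.
  rewrite kermx_eq0 /row_free neq_ltn (leq_ltn_trans (rank_leq_col M)) //.
case/rowV0Pn=> u /sub_kermxP uM /rV0Pn[i ui].
exists (u 0); split; first by exists i.
apply/mpolyP => mm; rewrite mcoeff0 linear_sum /=.
have [ltd|led] := ltnP (mdeg mm) d.
  have /matrixP/(_ 0 (enum_rank (BMultinom ltd))) := uM.
  rewrite [RHS]mxE mxE; apply: etrans; apply: eq_bigr => j _.
  by rewrite mcoeffZ mxE enum_rankK.
apply: big1 => j _; rewrite mcoeffZ [X in _ * X]memN_msupp_eq0 ?mulr0 //.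
by apply: contraTN led => /msize_mdeg_lt /leq_trans /(_ (gd j)); rewrite -ltnNge.
Qed.

Lemma lagrange_sum_neq0 (K : fieldType) (m : nat) (c beta : 'I_m -> K) i0 :
  injective c -> beta i0 != 0 ->
  \sum_i beta i *: \prod_(j | j != i) ('X - (c j)%:P) != 0.
Proof.
move=> c_inj bi0; apply/eqP => /(congr1 (horner^~ (c i0))).
rewrite horner0 horner_sum (bigD1 i0) //= [X in _ + X]big1 => [|i ne]; last first.
  rewrite hornerZ horner_prod (bigD1 i0) 1?eq_sym //=.
  by rewrite hornerXsubC subrr mul0r mulr0.
rewrite addr0 hornerZ horner_prod => /eqP; rewrite mulf_eq0 (negPf bi0) /=.
apply/negP/prodf_neq0 => j ne.
by rewrite hornerXsubC subr_eq0 (inj_eq c_inj) eq_sym.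
Qed.

Section Nullstellensatz.
Variable n : nat.
Local Notation A := {mpoly CC[n]}.

Lemma mpolyC_unit (c : CC) : c != 0 -> (c%:MP : A) \is a GRing.unit.
Proof.
by move=> c0; apply/unitrP; exists (c^-1)%:MP; rewrite -!mpolyCM mulVf ?mulfV.
Qed.

Lemma mpoly_char0 k : (k.+1%:R : A) \is a GRing.unit.
Proof.
by rewrite -[k.+1%:R](raddfMn (@mpolyC n CC)) mpolyC_unit ?Num.Theory.pnatr_eq0.
Qed.

Lemma prime_idealC (P : A -> Prop) (c : CC) :
  prime_ideal P -> P c%:MP -> c = 0.
Proof.
move=> prP Pc; apply/eqP; apply: contrapT => /negP c0.
case: (prP) => idP [P1 _]; apply: P1.
by rewrite -(mulVr (mpolyC_unit c0)); apply: idealMl.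
Qed.

(** Let N be maximal among the ideals over P avoiding the powers of a. If no f - c lies in N, each f
    - c divides a power of a modulo N, with some cofactor g. There are countably many pairs of an
    exponent and a size bound for g, so infinitely many c share one. A linear dependence among their
    cofactors gives a nonzero p over C with p(f) in N; p splits, so some f - z lies in N. *)
Lemma nullstellensatz (P : A -> Prop) (a : A) :
  prime_ideal P -> ~ P a ->
  exists N, [/\ prime_ideal N, subsetP P N, ~ N a &
    forall f : A, exists c : CC, N (f - c%:MP)].
Proof.
move=> prP Pa.
have [N [prN PN Na maxN]] := prime_avoiding_ideal (prime_ideal_ideal prP)
  (fun k => prime_idealX prP (k := k) Pa).
have idN := prime_ideal_ideal prN.
exists N; split=> // f; apply: contrapT => /forallNP Nf.
pose E (kd : nat * nat) := [set c : CC | exists2 g : A, (msize g <= kd.2)%N &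
  N (a ^+ kd.1 - g * (f - c%:MP))]%classic.
have [[k d] infE] : exists kd, infinite_set (E kd).
  apply: countable_cover_infinite => c; have [k [g Ng]] := maxN _ (Nf c).
  by exists (k, msize g), g.
pose m := #|{: 'X_{1..n < d}}|.+1.
have [B BE leB] := infinite_set_fset m infE.
pose c (i : 'I_m) := nth 0 (finmap.enum_fset B) i.
have c_inj : injective c.
  move=> i j /eqP; rewrite nth_uniq ?finmap.fset_uniq //; last 2 first.
  - exact: leq_trans (ltn_ord i) leB.
  - exact: leq_trans (ltn_ord j) leB.
  by move/eqP/val_inj.
have cE i : E (k, d) (c i).
  by apply: BE; apply: mem_nth; apply: leq_trans (ltn_ord i) leB.
pose g i := s2val (cid2 (cE i)).
have gd i : (msize (g i) <= d)%N by rewrite /g; case: cid2.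
have Ng i : N (a ^+ k - g i * (f - (c i)%:MP)) by rewrite /g; case: cid2.
have [beta [[i0 bi0] sum0]] := mpoly_linear_dependence gd (ltnSn _).
(* Modulo N, a^k p(f) is the vanishing sum of the beta_i g_i times the product of all f - c_j. *)
pose p := \sum_i beta i *: \prod_(j | j != i) ('X - (c j)%:P) : {poly CC}.
have p0 : p != 0 by exact: (lagrange_sum_neq0 c_inj bi0).
pose ev := horner_morph (fun y => mulrC f (@mpolyC n CC y)).
have evX z : ev ('X - z%:P) = f - z%:MP.
  by rewrite /ev rmorphB /= horner_morphX horner_morphC.
have evZ z q : ev (z *: q) = z%:MP * ev q.
  by rewrite /ev -mul_polyC rmorphM /= horner_morphC.
have evP z (r : seq 'I_m) (Q : pred 'I_m) :
    ev (z *: \prod_(j <- r | Q j) ('X - (c j)%:P)) =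
    z%:MP * \prod_(j <- r | Q j) (f - (c j)%:MP).
  rewrite evZ; congr (_ * _); rewrite /ev rmorph_prod /=.
  by apply: eq_bigr => j _; apply: evX.
have Np : N (ev p).
  apply: (prime_ideal_mem prN (a := a ^+ k)); last exact: prime_idealX.
  rewrite -[a ^+ k * _]subr0.
  have <- : \sum_i (beta i)%:MP * g i * \prod_j (f - (c j)%:MP) = 0.
    rewrite -mulr_suml (eq_bigr (fun i => beta i *: g i)) ?sum0 ?mul0r //.
    by move=> i _; rewrite mul_mpolyC.
  rewrite {1}/ev rmorph_sum mulr_sumr -sumrB; apply: ideal_sum => // i _.
  rewrite [X in _ * X - _]evP [X in _ - _ * X](bigD1 i) //=.
  set q := \prod_(j | _) _.
  have -> : a ^+ k * ((beta i)%:MP * q) -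
      (beta i)%:MP * g i * ((f - (c i)%:MP) * q) =
    (beta i)%:MP * q * (a ^+ k - g i * (f - (c i)%:MP)) by ring.
  exact: idealMl.
have [r Er] := closed_field_poly_normal p.
move: Np; rewrite Er evZ => /(prime_ideal_mem prN) Np.
have {}/Np : ~ N (lead_coef p)%:MP.
  by move=> /(prime_idealC prN)/eqP; rewrite lead_coef_eq0 (negPf p0).
rewrite /ev rmorph_prod /= => /(prime_ideal_prod prN)[z Nz].
by apply: (Nf z); rewrite -evX.
Qed.

Lemma constant_residues_maximal (N : A -> Prop) :
  prime_ideal N -> (forall f, exists c : CC, N (f - c%:MP)) -> maximal_ideal N.
Proof.
move=> prN Nc; have idN := prime_ideal_ideal prN.
split=> //; split; first by case: prN => _ [].
move=> J idJ NJ; have [JN|/existsNP[x /not_implyP[Jx Nx]]] := pselect (subsetP J N).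
  by left.
right; have [c Ncx] := Nc x.
have Jc : J c%:MP by apply: ideal_congr Jx => //; apply: NJ.
have c0 : c != 0.
  by apply/eqP => c0; apply: Nx; move: Ncx; rewrite c0 mpolyC0 subr0.
by rewrite -(mulVr (mpolyC_unit c0)); apply: idealMl.
Qed.

(** The Nullstellensatz with [a = 1] gives a proper ideal over [M], which is [M] by maximality. *)
Lemma maximal_ideal_residue (M : A -> Prop) :
  maximal_ideal M -> forall f, exists c : CC, M (f - c%:MP).
Proof.
move=> maxM; have prM := maximal_ideal_prime maxM; case: (maxM) => idM [M1 max].
have [N [prN MN N1 Nc]] := nullstellensatz prM M1.
have [NM|//] := max N (prime_ideal_ideal prN) MN.
by move=> f; have [c Nfc] := Nc f; exists c; apply: NM.
Qed.

End Nullstellensatz.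

(** * Extension of derivations modulo a prime *)

Section PolynomialEvaluation.
Variables (A S : comNzRingType) (phi : {rmorphism S -> A}) (x : A).

(** As a ring morphism, one evaluation can be the coefficient map of the next; nesting yields C[a],
    C[a][b], and so on. *)
Definition evp : {poly S} -> A := horner_morph (fun s => mulrC x (phi s)).
HB.instance Definition _ :=
  GRing.RMorphism.copy evp (horner_morph (fun s => mulrC x (phi s))).

Lemma evpC s : evp s%:P = phi s. Proof. exact: horner_morphC. Qed.

Lemma evpX : evp 'X = x. Proof. exact: horner_morphX. Qed.

Lemma evp_coef k (q : {poly S}) :
  (size q <= k)%N -> evp q = \sum_(i < k) phi q`_i * x ^+ i.
Proof.
move=> leqk; rewrite /evp /horner_morph (horner_coef_wide x (n := k)).
  by apply: eq_bigr => i _; rewrite coef_map.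
exact: leq_trans (size_poly _ _) leqk.
Qed.

Lemma evp_cons (q : {poly S}) s : evp (q * 'X + s%:P) = evp q * x + phi s.
Proof. by rewrite rmorphD rmorphM /= evpX evpC. Qed.

End PolynomialEvaluation.

Section Transcendence.
Variables (A : comUnitRingType) (P : A -> Prop) (d : A -> A).
Hypothesis char0 : forall k, (k.+1%:R : A) \is a GRing.unit.
Hypotheses (prP : prime_ideal P) (derd : derivation d).
Hypothesis Pd : forall a, P a -> P (d a).
Variables (S : comNzRingType) (phi : {rmorphism S -> A}) (x : A).
Hypothesis dphi : forall s, P (d (phi s)).

Let idP := prime_ideal_ideal prP.

Lemma derivation_evp q : P (d (evp phi x q) - evp phi x q^`() * d x).
Proof.
elim/poly_ind: q => [|q s IHq].
  rewrite deriv0 !rmorph0 (derivation0 derd) mul0r subr0; exact: ideal0.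
rewrite derivD derivM derivX derivC mulr1 addr0 evp_cons !rmorphD rmorphM /=.
rewrite evpX (derivationD derd) (derivationM derd).
set q' := evp _ _ q^`() in IHq *; set y := evp _ _ q in IHq *.
have -> : y * d x + d y * x + d (phi s) - (q' * x + y) * d x =
  x * (d y - q' * d x) + d (phi s) by ring.
by apply: idealD => //; apply: idealMl.
Qed.

(** If q(x) is in P, differentiating puts q'(x) d x, hence q'(x), in P. By induction on size the
    coefficients of q' lie in P; characteristic zero gives the nonconstant coefficients of q, and
    then the constant one follows. *)
Lemma derivation_transcendental (q : {poly S}) :
  ~ P (d x) -> P (evp phi x q) -> forall i, P (phi q`_i).
Proof.
move=> Pdx; have [k leqk] := ubnP (size q).
elim: k q leqk => // k IHk q leqk Pq.
have [->|q0] := eqVneq q 0; first by move=> i; rewrite coef0 rmorph0; apply: ideal0.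
have Pq' : P (evp phi x q^`()).
  apply: (prime_ideal_mem prP (a := d x)) => //; rewrite mulrC.
  by apply: (ideal_congr idP) (derivation_evp q) _; apply: Pd.
have Pcoef i : P (phi q`_i.+1).
  apply: (idealMn_unit idP (char0 i)); rewrite -raddfMn -coef_deriv.
  by apply: IHk => //; apply: leq_trans (lt_size_deriv q0) leqk.
case=> [|i //].
move: Pq; rewrite (evp_coef phi x (leqnSn (size q))) big_ord_recl expr0 mulr1.
set y := \sum_(i < _) _ => Py; rewrite -[phi _](addrK y); apply: idealB => //.
by apply: ideal_sum => // i _; apply: idealMr => //; apply: Pcoef.
Qed.

End Transcendence.

Section DerivationExtension.
Variables (A : comUnitRingType) (Q : A -> Prop).
Hypothesis char0 : forall k, (k.+1%:R : A) \is a GRing.unit.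
Hypothesis prQ : prime_ideal Q.
Let idQ := prime_ideal_ideal prQ.

(* A derivation [S -> A / Q] over [phi], lifted to [A], that factors through
   the image of [S] in [A / Q]. *)
Definition derivation_mod (S : comNzRingType) (phi : S -> A) (D : S -> A) :=
  [/\ forall x y, D (x + y) = D x + D y,
      forall x y, D (x * y) = phi x * D y + D x * phi y &
      forall s, Q (phi s) -> Q (D s)].

Section Step.
Variables (S : comNzRingType) (phi : {rmorphism S -> A}) (D : S -> A) (x : A).
Hypothesis derD : derivation_mod phi D.

Let DD a b : D (a + b) = D a + D b. Proof. by case: derD. Qed.
Let DM a b : D (a * b) = phi a * D b + D a * phi b. Proof. by case: derD. Qed.
Let D0 : D 0 = 0.
Proof. by have := DD 0 0; rewrite addr0 -[LHS]addr0 => /addrI. Qed.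
Let D1 : D 1 = 0.
Proof.
by have := DM 1 1; rewrite rmorph1 !mul1r !mulr1 -[LHS]addr0 => /addrI.
Qed.

Local Notation ev := (evp phi x).

(** Usually written q^D(x): [D] acts on coefficients, then [x] is substituted. *)
Definition coef_derivation (q : {poly S}) := \sum_(i < size q) D q`_i * x ^+ i.
Local Notation Dc := coef_derivation.

Lemma coef_derivation_wide k (q : {poly S}) :
  (size q <= k)%N -> Dc q = \sum_(i < k) D q`_i * x ^+ i.
Proof.
move=> leqk; rewrite /Dc (big_ord_widen _ (fun i => D q`_i * x ^+ i) leqk).
rewrite big_mkcond; apply: eq_bigr => i _; case: ltnP => // leqi.
by rewrite nth_default // D0 mul0r.
Qed.

Lemma coef_derivationD p q : Dc (p + q) = Dc p + Dc q.
Proof.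
pose k := maxn (size p) (size q).
rewrite !(@coef_derivation_wide k) ?leq_maxl ?leq_maxr ?size_polyD //.
by rewrite -big_split /=; apply: eq_bigr => i _; rewrite coefD DD mulrDl.
Qed.

Lemma coef_derivationC s : Dc s%:P = D s.
Proof.
by rewrite (@coef_derivation_wide 1) ?size_polyC_leq1 // big_ord1 coefC mulr1.
Qed.

Lemma coef_derivationMX q : Dc (q * 'X) = Dc q * x.
Proof.
rewrite (@coef_derivation_wide (size q).+1); last first.
  by rewrite (leq_trans (size_polyMleq _ _)) // size_polyX addn2.
rewrite big_ord_recl coefMX D0 mul0r add0r mulr_suml.
by apply: eq_bigr => i _; rewrite coefMX -mulrA -exprSr.
Qed.

Lemma coef_derivationCM s q : Dc (s%:P * q) = phi s * Dc q + D s * ev q.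
Proof.
rewrite (@coef_derivation_wide (size q)); last first.
  by rewrite mul_polyC size_scale_leq.
rewrite (evp_coef phi x (leqnn _)) !mulr_sumr -big_split /=; apply: eq_bigr => i _.
by rewrite coefCM DM mulrDl !mulrA.
Qed.

Lemma coef_derivationM p q : Dc (p * q) = ev p * Dc q + Dc p * ev q.
Proof.
elim/poly_ind: p => [|p s IHp].
  by rewrite mul0r rmorph0 -polyC0 coef_derivationC D0 !mul0r addr0.
rewrite mulrDl !coef_derivationD mulrAC !coef_derivationMX IHp evp_cons.
rewrite coef_derivationCM coef_derivationC; ring.
Qed.

Lemma coef_derivation_mem (q : {poly S}) :
  (forall i, Q (phi q`_i)) -> Q (Dc q).
Proof.
move=> Qq; apply: ideal_sum => // i _; apply: idealMr => //.
by case: derD => _ _; apply.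
Qed.

(** The extension to S[X] that is [e * D] on S and sends X to [u]; [e] plays the role of a common
    denominator. *)
Definition poly_derivation (e u : A) q := e * Dc q + ev q^`() * u.

Lemma poly_derivationD e u p q :
  poly_derivation e u (p + q) = poly_derivation e u p + poly_derivation e u q.
Proof. by rewrite /poly_derivation coef_derivationD derivD rmorphD /=; ring. Qed.

Lemma poly_derivationM e u p q :
  poly_derivation e u (p * q) =
  ev p * poly_derivation e u q + poly_derivation e u p * ev q.
Proof.
rewrite /poly_derivation coef_derivationM derivM rmorphD !rmorphM /=; ring.
Qed.

Lemma poly_derivationC e u s : poly_derivation e u s%:P = e * D s.
Proof. by rewrite /poly_derivation coef_derivationC derivC rmorph0 mul0r addr0. Qed.

Lemma poly_derivationX e u : poly_derivation e u 'X = u.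
Proof.
rewrite /poly_derivation -['X]mul1r coef_derivationMX -polyC1 coef_derivationC.
by rewrite D1 mul0r mulr0 add0r mul1r derivX rmorph1 mul1r.
Qed.

Lemma poly_derivation_mem e u (q : {poly S}) :
  (forall i, Q (phi q`_i)) -> Q (poly_derivation e u q).
Proof.
move=> Qq; apply: idealD => //; first exact/(idealMl idQ)/coef_derivation_mem.
apply: idealMr => //; rewrite (evp_coef phi x (leqnn _)).
apply: ideal_sum => // i _; apply: idealMr => //.
by rewrite coef_deriv raddfMn; apply: (idealMn idQ); apply: Qq.
Qed.

Lemma extend_transcendental u :
  (forall q, Q (ev q) -> forall i, Q (phi q`_i)) ->
  derivation_mod ev (poly_derivation 1 u).
Proof.
move=> trans; split; [exact: poly_derivationD|exact: poly_derivationM|].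
by move=> q /trans Qq; exact: poly_derivation_mem Qq.
Qed.

(* If [x] is algebraic over [S] modulo [Q] with minimal polynomial [m], the
   derivation must send [x] to [- m^D(x) / m'(x)]; scaling by [e := m'(x)]
   avoids the denominator. *)
Lemma extend_derivation :
  exists e u, ~ Q e /\ derivation_mod ev (poly_derivation e u).
Proof.
pose alg m := Q (ev m) /\ exists i, ~ Q (phi m`_i).
have [[m0 alg0]|none] := pselect (exists m, alg m); last first.
  exists 1, 0; split; first by case: prQ => _ [].
  apply: extend_transcendental => q Qq i; apply: contrapT => Qi.
  by apply: none; exists q; split=> //; exists i.
have exk : exists k, `[< exists2 m : {poly S}, size m = k & alg m >].
  by exists (size m0); apply/asboolP; exists m0.
case: (ex_minnP exk) => k /asboolP[m <- [Qm [i Qi]]] min {exk m0 alg0}.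
have minm (q : {poly S}) : (size q < size m)%N -> Q (ev q) -> forall j, Q (phi q`_j).
  move=> ltqm Qq j; apply: contrapT => Qj; move: ltqm; rewrite ltnNge => /negP.
  by apply; apply: min; apply/asboolP; exists q => //; split=> //; exists j.
have m0 : m != 0.
  by apply/eqP => m0; apply: Qi; rewrite m0 coef0 rmorph0; apply: ideal0.
(* Otherwise dropping the leading term gives a shorter relation that still has a coefficient outside
   [Q]. *)
have Qlead : ~ Q (phi (lead_coef m)).
  move=> Ql; apply: Qi.
  have [ltim|leim] := ltnP i (size m).-1; last first.
    move: leim; rewrite leq_eqVlt => /predU1P[<- //|].
    rewrite prednK ?size_poly_gt0 // => leim.
    by rewrite nth_default // rmorph0; apply: ideal0.
  pose q := m - (lead_coef m)%:P * 'X^((size m).-1).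
  have := @minm q _ _ i; rewrite /q coefB coefCM coefXn ltn_eqF // mulr0 subr0.
  apply.
    rewrite -[X in (_ < X)%N](prednK (n := size m)) ?size_poly_gt0 // ltnS.
    apply/leq_sizeP => j lej; rewrite coefB coefCM coefXn.
    move: lej; rewrite leq_eqVlt => /predU1P[<-|ltj].
      by rewrite eqxx mulr1 subrr.
    rewrite gtn_eqF // mulr0 subr0 nth_default //.
    by rewrite prednK ?size_poly_gt0 in ltj.
  rewrite rmorphB rmorphM /= evpC; apply: idealB => //.
  exact: idealMr.
have gt1 : (1 < size m)%N.
  rewrite ltnNge; apply/negP => /size1_polyC m1; apply: Qlead.
  by move: Qm; rewrite m1 lead_coefC evpC.
pose e := ev m^`(); pose u := - Dc m.
have Qe : ~ Q e.
  move=> /(minm _ (lt_size_deriv m0))/(_ (size m).-2).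
  rewrite coef_deriv raddfMn /= => /(idealMn_unit idQ (char0 _)).
  have -> : (size m).-2.+1 = (size m).-1 by move: gt1; case: (size m) => [|[]].
  exact: Qlead.
exists e, u; split=> //.
split; [exact: poly_derivationD|exact: poly_derivationM|] => q Qq.
(* Pseudo-division, as the leading coefficient need not be invertible. The remainder is too short to
   be a relation, so its coefficients lie in [Q]; since the derivation kills [m], it sends [q] into
   [Q]. *)
pose c := lead_coef m ^+ Pdiv.CommonRing.rscalp q m.
pose g := Pdiv.CommonRing.rdivp q m; pose r := Pdiv.CommonRing.rmodp q m.
have Eq : c%:P * q = g * m + r.
  by rewrite mul_polyC; apply: Pdiv.ComRing.rdivp_eq.
have Qr : Q (ev r).
  have -> : r = c%:P * q - g * m by rewrite Eq addrC addKr.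
  by rewrite rmorphB !rmorphM /=; apply: idealB => //; apply: idealMl.
have Qcoefr : forall j, Q (phi r`_j).
  by apply: minm => //; rewrite Pdiv.CommonRing.ltn_rmodp.
have Dm : poly_derivation e u m = 0.
  by rewrite /poly_derivation /u -/e mulrN subrr.
have Qc : ~ Q (phi c) by rewrite rmorphXn; apply: prime_idealX.
apply: (prime_ideal_mem prQ _ Qc).
have := congr1 (poly_derivation e u) Eq.
rewrite poly_derivationD !poly_derivationM Dm mulr0 add0r evpC.
move=> /(congr1 (fun z => z - poly_derivation e u c%:P * ev q)).
rewrite addrK => ->.
apply: idealB => //; last exact: idealMl.
apply: idealD => //; first exact: idealMl.
exact: poly_derivation_mem.
Qed.

End Step.
End DerivationExtension.

(** * A vector field tangent to [Q] that kills [a] and [b] but not [h] *)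

Section TangentVector.
Variable n : nat.
Local Notation A := {mpoly CC[n]}.

Definition directional (v : 'I_n -> A) (p : A) : A := \sum_j p^`M(j) * v j.

Lemma directional_derivation v : derivation (directional v).
Proof.
split=> p q; rewrite /directional.
  by rewrite -big_split /=; apply: eq_bigr => j _; rewrite mderivD mulrDl.
rewrite mulr_sumr mulr_suml -big_split /=; apply: eq_bigr => j _.
by rewrite mderivM; ring.
Qed.

Lemma directionalZ v c p : directional v (c *: p) = c%:MP * directional v p.
Proof.
rewrite /directional mulr_sumr; apply: eq_bigr => j _.
by rewrite mderivZ -mul_mpolyC mulrA.
Qed.

Lemma directionalC v c : directional v c%:MP = 0.
Proof. by apply: big1 => j _; rewrite mderivC mul0r. Qed.

Lemma directionalX v j : directional v 'X_j = v j.
Proof.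
rewrite /directional (bigD1 j) //= big1 => [|i ne].
  have Uj : (U_(j) - U_(j))%MM = 0%MM :> 'X_{1..n}.
    by apply/mnmP => k; rewrite mnmBE mnm0E subnn.
  by rewrite mderivX mnm1E eqxx Uj mpolyX0 mulr1n scale1r mul1r addr0.
by rewrite mderivX mnm1E eq_sym (negPf ne) mulr0n scale0r mul0r.
Qed.

Variables (br : A -> A -> A) (P Q : A -> Prop) (a b h : A).
Hypothesis brD : forall r, derivation (br^~ r).
Hypothesis brC : forall (c : CC) r, br c%:MP r = 0.
Hypothesis braa : forall r, br r r = 0.
Hypotheses (Pab : ~ P (br a b)) (Pba : ~ P (br b a)).
Hypotheses (pP : poisson_prime br P) (prQ : prime_ideal Q).
Hypotheses (QP : subsetP Q P) (Ph : P h) (Qh : ~ Q h).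

Let prP : prime_ideal P. Proof. by case: pP. Qed.
Let idP := prime_ideal_ideal prP.
Let idQ := prime_ideal_ideal prQ.
Let brP r p : P p -> P (br p r). Proof. by case: pP => -[_ +] _; apply. Qed.
Let char0 := @mpoly_char0 n.

Local Notation phia := (evp (@mpolyC n CC) a).
Local Notation phiab := (evp phia b).

(** Modulo P, [br^~ b] does not kill a, so a is transcendental over C; [br^~ a] kills the
    polynomials in a but not b, so b is transcendental over C[a]. *)
Lemma evp2_eq0 (q : {poly {poly CC}}) : P (phiab q) -> q = 0.
Proof.
move=> Pq; apply/polyP => i; rewrite coef0; apply/polyP => j; rewrite coef0.
apply: (prime_idealC prP).
apply: (derivation_transcendental char0 prP (brD b) (brP b) _ Pab) => [c|].
  by rewrite brC; apply: ideal0.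
apply: (derivation_transcendental char0 prP (brD a) (brP a) _ Pba) => // s.
have : P (br (phia s) a - phia s^`() * br a a).
  apply: (derivation_evp prP (brD a)) => c.
  by rewrite brC; apply: ideal0.
by rewrite braa mulr0 subr0.
Qed.

(** As h lies in P, the constant term of a relation in h modulo Q lies in P, so it is zero by
    independence of a and b. Outside Q, h can be cancelled, and induction applies. *)
Lemma evp3_transcendental q : Q (evp phiab h q) -> forall i, Q (phiab q`_i).
Proof.
elim/poly_ind: q => [|q s IHq].
  by move=> _ i; rewrite coef0 rmorph0; apply: ideal0.
rewrite evp_cons => Qq.
have s0 : s = 0.
  apply: evp2_eq0; apply: (ideal_congr idP (a := evp phiab h q * h + phiab s)).
    by rewrite addrK; apply: idealMl.
  exact: QP.
move: Qq; rewrite s0 rmorph0 !addr0 mulrC => /(prime_ideal_mem prQ)/(_ Qh).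
by move=> /IHq Qi [|i]; rewrite coefMX //= rmorph0; apply: ideal0.
Qed.

(** Start from d/dh on C[a][b][h] and adjoin the variables x_j one at a time. Each extension
    multiplies the old derivation by some e outside Q, so the value at h stays outside Q. At [k = n]
    the map [phi] is onto. *)
Lemma derivation_tower k :
  exists (S : comNzRingType) (phi : {rmorphism S -> A}) (D : S -> A),
  [/\ derivation_mod Q phi D,
      forall c : CC, exists2 y, phi y = c%:MP & D y = 0,
      (exists2 y, phi y = a & D y = 0) /\ (exists2 y, phi y = b & D y = 0),
      exists2 y, phi y = h & ~ Q (D y) &
      forall j : 'I_n, (j < k)%N -> exists y, phi y = 'X_j].
Proof.
elim: k => [|k [S [phi [D [derD Dc [[ya Ea Da] [yb Eb Db]] [yh Eh Dh] Dx]]]]].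
  pose D0 (q : {poly {poly CC}}) : A := 0.
  have der0 : derivation_mod Q phiab D0.
    split=> [x y|x y|s _]; rewrite /D0 ?addr0 ?mulr0 ?mul0r ?addr0 //.
    exact: ideal0.
  have derD := extend_transcendental prQ (x := h) der0 1 evp3_transcendental.
  exists {poly {poly {poly CC}}}, (evp phiab h), (poly_derivation phiab D0 h 1 1).
  split=> //.
  - move=> c; exists (c%:P%:P%:P); first by rewrite /= evpC /= evpC /= evpC.
    by rewrite (poly_derivationC _ der0) mulr0.
  - split; first exists ('X%:P%:P); first by rewrite /= evpC /= evpC /= evpX.
      by rewrite (poly_derivationC _ der0) mulr0.
    exists ('X%:P); first by rewrite /= evpC /= evpX.
    by rewrite (poly_derivationC _ der0) mulr0.
  - exists 'X; first by rewrite /= evpX.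
    by rewrite (poly_derivationX _ der0); case: prQ => _ [].
have [ltkn|lenk] := ltnP k n; last first.
  exists S, phi, D; split=> //; first by split; [exists ya|exists yb].
    by exists yh.
  by move=> j _; apply: Dx; apply: leq_trans (ltn_ord j) lenk.
have [e [u [Qe derD']]] := extend_derivation char0 prQ 'X_(Ordinal ltkn) derD.
exists {poly S}, (evp phi 'X_(Ordinal ltkn)),
  (poly_derivation phi D 'X_(Ordinal ltkn) e u).
split=> //.
- move=> c; have [y Ey Dy] := Dc c; exists (y%:P); first by rewrite /= evpC.
  by rewrite (poly_derivationC _ derD) Dy mulr0.
- split; [exists (ya%:P)|exists (yb%:P)]; rewrite /= ?evpC //.
    by rewrite (poly_derivationC _ derD) Da mulr0.
  by rewrite (poly_derivationC _ derD) Db mulr0.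
- exists (yh%:P); first by rewrite /= evpC.
  by rewrite (poly_derivationC _ derD); apply: prime_idealM.
- move=> j; rewrite ltnS leq_eqVlt => /predU1P[jk|/Dx[y Ey]].
    by exists 'X; rewrite /= evpX; congr 'X_(_); apply: val_inj.
  by exists (y%:P); rewrite /= evpC.
Qed.

(** Through the surjection [phi], the derivation at the top of the tower descends to A modulo Q,
    where it is the vector field with components D(y_j). *)
Lemma tangent_vector : exists v : 'I_n -> A,
  [/\ forall p, Q p -> Q (directional v p), Q (directional v a),
      Q (directional v b) & ~ Q (directional v h)].
Proof.
have [S [phi [D [derD Dc [[ya Ea Da] [yb Eb Db]] [yh Eh Dh] Dx]]]] :=
  derivation_tower n.
have [DD DM Dker] := derD.
have /choice[y Ey] : forall j : 'I_n, exists y, phi y = 'X_j.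
  by move=> j; apply: Dx.
pose v j := D (y j).
have lift p : exists2 z, phi z = p & Q (D z - directional v p).
  elim/mpolyind: p => [|c m p _ _ [z Ez Qz]].
    have [z Ez Dz] := Dc 0; exists z; first by rewrite Ez mpolyC0.
    by rewrite Dz (derivation0 (directional_derivation v)) subrr; apply: ideal0.
  have liftM p1 p2 : (exists2 z, phi z = p1 & Q (D z - directional v p1)) ->
      (exists2 z, phi z = p2 & Q (D z - directional v p2)) ->
      exists2 z, phi z = p1 * p2 & Q (D z - directional v (p1 * p2)).
    move=> [z1 E1 Q1] [z2 E2 Q2]; exists (z1 * z2); first by rewrite rmorphM E1 E2.
    rewrite DM E1 E2 (derivationM (directional_derivation v)).
    set d1 := directional v p1 in Q1 *; set d2 := directional v p2 in Q2 *.
    have -> : p1 * D z2 + D z1 * p2 - (p1 * d2 + d1 * p2) =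
      p1 * (D z2 - d2) + p2 * (D z1 - d1) by ring.
    by apply: idealD => //; apply: idealMl.
  have liftC c' : exists2 z, phi z = c'%:MP & Q (D z - directional v c'%:MP).
    have [z' Ez' Dz'] := Dc c'; exists z'; first exact: Ez'.
    by rewrite Dz' directionalC subrr; apply: ideal0 idQ.
  have lift1 := liftC 1; rewrite mpolyC1 in lift1.
  have liftX : exists2 z, phi z = 'X_[m] & Q (D z - directional v 'X_[m]).
    rewrite mpolyXE_id; elim/big_rec: _ => [|i q _ IH]; first exact: lift1.
    apply: (liftM _ _ _ IH); elim: (m i) => [|l IHl]; first exact: lift1.
    rewrite exprS; apply: (liftM _ _ _ IHl); exists (y i); first exact: Ey.
    by rewrite directionalX subrr; apply: ideal0 idQ.
  have [z' Ez' Qz'] := liftM _ _ (liftC c) liftX.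
  exists (z' + z); first by rewrite rmorphD Ez Ez' mul_mpolyC.
  rewrite DD -mul_mpolyC (derivationD (directional_derivation v)) opprD addrACA.
  exact: (idealD idQ Qz' Qz).
(* Two lifts of one polynomial differ by an element of the kernel of [phi], which [D] sends into
   [Q]. *)
have dirE z : Q (D z - directional v (phi z)).
  have [z' Ez' Qz'] := lift (phi z).
  apply: (ideal_congl idQ _ Qz').
  have -> : D z - directional v (phi z) - (D z' - directional v (phi z)) =
    D z - D z' by ring.
  have -> : D z = D (z - z') + D z' by rewrite -DD subrK.
  by rewrite addrK; apply: Dker; rewrite rmorphB Ez' subrr; apply: ideal0.
exists v; split.
- move=> p Qp; have [z Ez Qz] := lift p.
  by apply: (ideal_congr idQ Qz); apply: Dker; rewrite Ez.
- by have := dirE ya; rewrite Ea Da sub0r => /(idealN idQ); rewrite opprK.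
- by have := dirE yb; rewrite Eb Db sub0r => /(idealN idQ); rewrite opprK.
- move=> Qdh; apply: Dh; apply: (ideal_congl idQ (dirE yh)); by rewrite Eh.
Qed.

End TangentVector.

(** * The Dixmier-Moeglin implications for a general bracket *)

Section DixmierMoeglin.
Variable n : nat.
Local Notation A := {mpoly CC[n]}.
Variable br : A -> A -> A.
Hypothesis brD : forall r, derivation (br^~ r).
Hypothesis brC : forall (c : CC) r, br c%:MP r = 0.

Let char0 := @mpoly_char0 n.

Lemma denominator_poisson P a b :
  poisson_prime br P -> ~ P b ->
  (forall r, P (br a r * b - a * br b r)) ->
  poisson_ideal br (fun x => exists y, P (x * a - y * b)) /\
  (forall x y, P (x * a - y * b) -> forall r, P (br y r * x - y * br x r)).
Proof.
move=> [[_ brP] prP] Pb cab; have idP := prime_ideal_ideal prP.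
have derxy x y r : P (x * a - y * b) -> P (br x r * a - br y r * b).
  move=> Pxy; apply: (prime_ideal_mem prP _ Pb).
  have := brP _ r Pxy.
  rewrite (derivationB (brD r)) !(derivationM (brD r)) => Pd.
  have -> : b * (br x r * a - br y r * b) =
    b * (x * br a r + br x r * a - (y * br b r + br y r * b)) +
    (- x * (br a r * b - a * br b r) - br b r * (x * a - y * b)) by ring.
  by apply: (idealD idP); [|apply: (idealB idP)]; apply: (idealMl idP).
split; [split; [split; [|split]|]|].
- by exists 0; rewrite !mul0r subrr; apply: ideal0.
- move=> x x' [y Py] [y' Py']; exists (y + y').
  have -> : (x + x') * a - (y + y') * b = x * a - y * b + (x' * a - y' * b) by ring.
  exact: idealD.
- move=> r x [y Py]; exists (r * y); rewrite -!mulrA -mulrBr; exact: idealMl.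
- by move=> x r [y Py]; exists (br y r); apply: derxy.
move=> x y Pxy r; apply: (prime_ideal_mem prP _ Pb).
have -> : b * (br y r * x - y * br x r) =
  br x r * (x * a - y * b) - x * (br x r * a - br y r * b) by ring.
by apply: (idealB idP); apply: (idealMl idP); [|apply: derxy].
Qed.

(** This is the contraction to A of the ideal generated by w in (A/P)[1/x]; the central element w/x
    generates the same ideal, which is therefore Poisson. *)
Lemma numerator_poisson P x w :
  poisson_ideal br P -> (forall r, P (br w r * x - w * br x r)) ->
  poisson_ideal br (fun u => exists k v, P (x ^+ k * u - v * w)).
Proof.
move=> [idP brP] cxw; split; [split; [|split]|].
- by exists 0, 0; rewrite mulr0 mul0r subrr; apply: ideal0.
- move=> u u' [k [v Pv]] [k' [v' Pv']].
  exists (k + k')%N, (x ^+ k' * v + x ^+ k * v').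
  have -> : x ^+ (k + k') * (u + u') - (x ^+ k' * v + x ^+ k * v') * w =
    x ^+ k' * (x ^+ k * u - v * w) + x ^+ k * (x ^+ k' * u' - v' * w).
    by rewrite exprD; ring.
  by apply: idealD => //; apply: idealMl.
- move=> r u [k [v Pv]]; exists k, (r * v).
  by rewrite mulrCA -mulrA -mulrBr; apply: idealMl.
move=> u r [k [v Pv]].
(* Bracket x^k u = v w with r and multiply by x; then replace x {w, r} by w {x, r} and x^k u by v
   w. *)
exists k.+1, (x * br v r + v * br x r - k%:R * v * br x r).
have := idealMl idP x (brP _ r Pv).
rewrite (derivationB (brD r)) !(derivationM (brD r)).
have Dk := derivationX (brD r) x k; rewrite -mulr_natl in Dk.
set dk := br (x ^+ k) r in Dk *.
move=> Pd.
have -> : x ^+ k.+1 * br u r -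
    (x * br v r + v * br x r - k%:R * v * br x r) * w =
  x * (x ^+ k * br u r + dk * u - (v * br w r + br v r * w)) +
  (v * (br w r * x - w * br x r) - k%:R * br x r * (x ^+ k * u - v * w)).
  have -> : x * (x ^+ k * br u r + dk * u - (v * br w r + br v r * w)) =
    x ^+ k.+1 * br u r + (dk * x) * u - x * v * br w r - x * br v r * w.
    by rewrite exprS; ring.
  by rewrite Dk; ring.
by apply: idealD => //; apply: idealB => //; apply: idealMl.
Qed.

Lemma poisson_primitive_rational P :
  poisson_primitive br P -> rational_pp br P.
Proof.
move=> primP a b Pb cab.
have [pP prP] := poisson_primitive_prime char0 brD primP.
have idP := prime_ideal_ideal prP.
case: primP => M [maxM [_ [PM coreP]]].
have prM := maximal_ideal_prime maxM; have idM := prime_ideal_ideal prM.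
have [pD cxy] := denominator_poisson (conj pP prP) Pb cab.
(* If all denominators lay in [M], the denominator ideal would lie in the core [P], yet it contains
   [b]. *)
have [DM|] := pselect (subsetP (fun x => exists y, P (x * a - y * b)) M).
  by case: Pb; apply: (coreP _ pD DM); exists a; rewrite mulrC subrr; apply: ideal0.
move=> /existsNP[x /not_implyP[[y Pxy] Mx]].
have [al May] := maximal_ideal_residue maxM y.
have [be Mbx] := maximal_ideal_residue maxM x.
have be0 : be != 0.
  by apply/eqP => be0; apply: Mx; rewrite be0 mpolyC0 subr0 in Mbx.
(* The value of y/x at [M]. *)
pose c := al / be; exists c.
pose w := y - c%:MP * x.
have Mw : M w.
  have -> : w = (y - al%:MP) - c%:MP * (x - be%:MP).
    by rewrite mulrBr -mpolyCM divfK // /w; ring.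
  by apply: idealB => //; apply: idealMl.
have cw r : P (br w r * x - w * br x r).
  have -> : br w r * x - w * br x r = br y r * x - y * br x r.
    rewrite /w (derivationB (brD r)) (derivationM (brD r)) brC; ring.
  exact: cxy.
(* As [x] is outside [M], the Poisson ideal of [numerator_poisson] lies in [M], hence in the core
   [P]; it contains [w]. *)
have Pw : P w.
  apply: (coreP _ (numerator_poisson pP cw)); last first.
    by exists 0, 1; rewrite !mul1r subrr; apply: ideal0.
  move=> u [k [v /PM Mu]].
  apply: (prime_ideal_mem prM (a := x ^+ k)); last exact: prime_idealX.
  by apply: (ideal_congl idM Mu); apply: idealMl.
have Px : ~ P x by move=> /PM.
apply: (prime_ideal_mem prP _ Px).
have -> : x * (a - c *: b) = (x * a - y * b) + b * w.
  by rewrite /w -mul_mpolyC; ring.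
by apply: idealD => //; apply: idealMl.
Qed.

(** Take a maximal ideal N over P avoiding the witness a. A core of N larger than P would be a
    Poisson prime strictly above P, hence contain a. *)
Lemma locally_closed_primitive P :
  poisson_prime br P -> locally_closed br P -> poisson_primitive br P.
Proof.
move=> [pP prP] [a [Pa clP]].
have [N [prN PN Na Nc]] := nullstellensatz prP Pa.
have idN := prime_ideal_ideal prN.
exists N; split; first exact: constant_residues_maximal.
suff -> : P = poisson_core br N by apply: poisson_core_is_core.
apply/funext => x; apply/propext; split; first exact: poisson_core_max.
move=> Cx; apply: contrapT => Px; apply: Na.
apply: (@poisson_core_sub _ br); apply: clP.
  by split; [exact: poisson_core_ideal|exact: poisson_core_prime].
by split; [exact: poisson_core_max|exists x].
Qed.

Lemma maximal_locally_closed P : maximal_ideal P -> locally_closed br P.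
Proof.
move=> [_ [P1 maxP]]; exists 1; split=> // Q [_ prQ] [PQ [x [Qx Px]]].
by have [/(_ _ Qx)|] := maxP Q (prime_ideal_ideal prQ) PQ.
Qed.

(** When brackets vanish modulo [P], every f/1 is central, so every f is constant modulo [P]. *)
Lemma residually_null_rational P :
  prime_ideal P -> residually_null br P -> rational_pp br P -> maximal_ideal P.
Proof.
move=> prP nullP ratP; have idP := prime_ideal_ideal prP.
apply: constant_residues_maximal => // f.
have P1 : ~ P 1 by case: prP => _ [].
have [|c Pc] := ratP f 1 P1; last by exists c; rewrite -[c%:MP]mulr1 mul_mpolyC.
move=> r; apply: idealB => //; [exact: idealMr|exact: idealMl].
Qed.

End DixmierMoeglin.

(** * The Jacobian bracket *)

Section JacobianBracket.
Variables (n : nat) (s t : 'I_(n - 2) -> {mpoly CC[n]}).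
Hypothesis hn : (3 <= n)%N.
Local Notation A := {mpoly CC[n]}.
Local Notation br := (pbracket s t).

Let i0 : 'I_n := Ordinal (ltn_trans (isT : 0 < 2)%N hn).
Let i1 : 'I_n := Ordinal (ltn_trans (isT : 1 < 2)%N hn).

(** The first row is left free: the determinant is linear in it, which makes the bracket a vector
    field and lets other rows replace df. *)
Definition bracket_mx (w : 'I_n -> A) (g : A) : 'M[A]_n :=
  \matrix_(k < n, j < n) (if val k == 0%N then w j
    else if val k == 1%N then g^`M(j) else jac_row s t (val k) j).

Lemma det_bracket_mx g :
  exists c : 'I_n -> A, forall w, \det (bracket_mx w g) = \sum_j w j * c j.
Proof.
(* Cofactors along row 0 do not depend on that row, so zeros can fill it. *)
exists (cofactor (bracket_mx (fun=> 0) g) i0) => w.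
rewrite (expand_det_row _ i0); apply: eq_bigr => j _.
rewrite [X in X * _]mxE /=; congr (_ * (_ * \det _)).
by apply/matrixP => k l; rewrite !mxE.
Qed.

Lemma pbracketE f g : br f g = \det (bracket_mx (fun j => f^`M(j)) g).
Proof. by []. Qed.

Lemma pbracket_derivation r : derivation (br^~ r).
Proof.
have [c cE] := det_bracket_mx r.
have E f : br f r = directional c f by rewrite pbracketE cE.
have [dD dM] := directional_derivation c.
by split=> a b; rewrite !E ?dD ?dM.
Qed.

Lemma pbracketC c r : br c%:MP r = 0.
Proof.
have [d dE] := det_bracket_mx r; rewrite pbracketE dE.
by apply: big1 => j _; rewrite mderivC mul0r.
Qed.

Lemma pbracketaa a : br a a = 0.
Proof. by apply: (@determinant_alternate _ _ _ i0 i1) => // j; rewrite !mxE. Qed.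

Lemma pbracket_swap a b : br b a = - br a b.
Proof.
have -> : br b a = \det (xrow i0 i1 (bracket_mx (fun j => a^`M(j)) b)).
  congr (\det _); apply/matrixP => k j; rewrite !mxE.
  case: tpermP => [->|->|/eqP k0 /eqP k1]; [by []|by []|].
  by rewrite -!(inj_eq val_inj) /= in k0 k1; rewrite (negPf k0) (negPf k1).
by rewrite xrowE det_mulmx det_perm odd_tperm /= expr1 mulN1r.
Qed.

Lemma jac_rowE (i : 'I_(n - 2)) j :
  jac_row s t (i.+2) j = t i * (s i)^`M(j) - s i * (t i)^`M(j).
Proof. by rewrite /jac_row (_ : i.+2 - 2 = i)%N ?valK // -addn2 addnK. Qed.

Lemma row_index_lt (i : 'I_(n - 2)) : (i.+2 < n)%N.
Proof. by have := ltn_ord i; rewrite ltn_subRL add2n. Qed.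

(** The Casimir property of s_i/t_i with denominators cleared: the difference of both sides is the
    determinant with first row t_i ds_i - s_i dt_i, which repeats row i + 2. *)
Lemma pbracket_central i r : br (s i) r * t i = s i * br (t i) r.
Proof.
apply/eqP; rewrite -subr_eq0; apply/eqP.
have [c cE] := det_bracket_mx r.
rewrite !pbracketE !cE mulr_suml mulr_sumr -sumrB.
pose w j := t i * (s i)^`M(j) - s i * (t i)^`M(j).
transitivity (\det (bracket_mx w r)).
  by rewrite cE; apply: eq_bigr => j _; rewrite /w; ring.
apply: (@determinant_alternate _ _ _ i0 (Ordinal (row_index_lt i))) => // j.
by rewrite !mxE /= jac_rowE.
Qed.

(** Modulo Q the bracket matrix kills v, and its determinant {a, b} is nonzero; multiplying by the
    adjugate gives v = 0. *)
Lemma jacobian_kernel (Q : A -> Prop) (v : 'I_n -> A) (lam mu : 'I_(n - 2) -> CC) a b :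
  prime_ideal Q -> (forall i, (lam i, mu i) != (0, 0)) ->
  (forall i, Q (lam i *: s i - mu i *: t i)) ->
  (forall p, Q p -> Q (directional v p)) ->
  Q (directional v a) -> Q (directional v b) -> ~ Q (br a b) ->
  forall j, Q (v j).
Proof.
move=> prQ lm0 QJ Qv Qa Qb Qab j; have idQ := prime_ideal_ideal prQ.
apply: (prime_ideal_mem prQ _ Qab).
set B := bracket_mx (fun j => a^`M(j)) b.
have Brow k : Q (\sum_l B k l * v l).
  have [k0|k0] := eqVneq (val k) 0%N.
    by under eq_bigr => l _ do rewrite mxE k0 /=.
  have [k1|k1] := eqVneq (val k) 1%N.
    by under eq_bigr => l _ do rewrite mxE k1 /=.
  have ltk : (k - 2 < n - 2)%N.
    by apply: ltn_sub2r (ltn_ord k).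
  pose i := Ordinal ltk : 'I_(n - 2).
  have Ek : val k = i.+2.
    rewrite /i /= -addn2 subnK //.
    by move: k0 k1 => /=; case: (nat_of_ord k) => [|[]].
  have -> : \sum_l B k l * v l =
      t i * directional v (s i) - s i * directional v (t i).
    rewrite /directional !mulr_sumr -sumrB; apply: eq_bigr => l _.
    by rewrite mxE (negPf k0) (negPf k1) Ek jac_rowE mulrBl !mulrA.
  have := Qv _ (QJ i).
  have [dD dM] := directional_derivation v.
  rewrite (derivationB (directional_derivation v)) !directionalZ.
  have := QJ i; rewrite -!mul_mpolyC.
  set ds := directional v (s i); set dt := directional v (t i) => Qf Qdf.
  (* Eliminate between the pencil member and its derivative along [v], then cancel whichever of
     [lam i], [mu i] is nonzero. *)
  have [l0|l0] := eqVneq (lam i) 0.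
    have m0 : mu i != 0 by have := lm0 i; rewrite l0 xpair_eqE eqxx.
    apply: (prime_ideal_mem prQ (a := (mu i)%:MP)); last first.
      by move=> /(prime_idealC prQ)/eqP; apply/negP.
    have -> : (mu i)%:MP * (t i * ds - s i * dt) =
      s i * ((lam i)%:MP * ds - (mu i)%:MP * dt) -
      ds * ((lam i)%:MP * s i - (mu i)%:MP * t i) by ring.
    by apply: idealB => //; apply: idealMl.
  apply: (prime_ideal_mem prQ (a := (lam i)%:MP)); last first.
    by move=> /(prime_idealC prQ)/eqP; apply/negP.
  have -> : (lam i)%:MP * (t i * ds - s i * dt) =
    t i * ((lam i)%:MP * ds - (mu i)%:MP * dt) -
    dt * ((lam i)%:MP * s i - (mu i)%:MP * t i) by ring.
  by apply: idealB => //; apply: idealMl.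
have -> : br a b * v j = \sum_k (\adj B) j k * (\sum_l B k l * v l).
  have /matrixP/(_ j 0) : \adj B *m (B *m \col_l v l) = br a b *: \col_l v l.
    by rewrite mulmxA mul_adj_mx mul_scalar_mx.
  rewrite [in RHS]mxE [in RHS]mxE => <-; rewrite mxE; apply: eq_bigr => k _.
  by congr (_ * _); rewrite mxE; apply: eq_bigr => l _; rewrite [X in _ * X]mxE.
by apply: ideal_sum => // k _; apply: idealMl.
Qed.

Lemma gen_ideal_subset k (f : 'I_k -> A) (P : A -> Prop) :
  ideal P -> (subsetP (gen_ideal f) P <-> forall i, P (f i)).
Proof.
move=> idP; split=> [sub i|Pf x [a ->]]; last first.
  by apply: ideal_sum => // i _; apply: idealMr.
apply: sub; exists (fun j => (j == i)%:R).
rewrite (bigD1 i) //= eqxx mulr1 big1 ?addr0 // => j /negPf ->.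
by rewrite mulr0.
Qed.

(** * Poisson primes over a fixed choice of pencil members *)

Section PoissonPrimes.
Variables (lam mu : 'I_(n - 2) -> CC).
Hypothesis lm0 : forall i, (lam i, mu i) != (0, 0).

(** An h in P outside Q would give a vector field tangent to Q, killing a and b but not h modulo Q;
    yet [jacobian_kernel] forces all its components into Q. *)
Lemma poisson_prime_minimal P Q :
  poisson_prime br P -> ~ residually_null br P -> prime_ideal Q ->
  (forall i, Q (lam i *: s i - mu i *: t i)) -> subsetP Q P -> subsetP P Q.
Proof.
move=> pP nullP prQ QJ QP h Ph; apply: contrapT => Qh.
have idQ := prime_ideal_ideal prQ.
move/existsNP: nullP => [a /existsNP[b Pab]].
have Pba : ~ P (br b a).
  move=> Pba; apply: Pab; rewrite -[br a b]opprK -pbracket_swap.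
  by apply: idealN => //; case: pP => -[].
have [v [Qv Qa Qb Qvh]] := tangent_vector pbracket_derivation pbracketC pbracketaa
  Pab Pba pP prQ QP Ph Qh.
apply: Qvh; apply: ideal_sum => // j _; apply: idealMl => //.
apply: (jacobian_kernel prQ lm0 QJ Qv Qa Qb) => Qab.
exact/Pab/QP.
Qed.

Lemma poisson_prime_locally_closed P :
  poisson_prime br P -> ~ residually_null br P ->
  (forall i, P (lam i *: s i - mu i *: t i)) -> locally_closed br P.
Proof.
move=> [pP prP] nullP PJ.
move/existsNP: (nullP) => [a /existsNP[b Pab]].
(* A Poisson prime [Q] above [P] that misses [br a b] is not residually null, so minimality applied
   to [P] inside [Q] gives [Q] inside [P]. *)
exists (br a b); split=> // Q pQ [PQ [x [Qx Px]]]; apply: contrapT => Qab.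
apply: Px; apply: (poisson_prime_minimal pQ) Qx => //.
Qed.

End PoissonPrimes.

Lemma rational_contains_pencil P :
  prime_ideal P -> rational_pp br P ->
  exists lam mu : 'I_(n - 2) -> CC,
    (forall i, (lam i, mu i) != (0, 0)) /\
    forall i, P (lam i *: s i - mu i *: t i).
Proof.
move=> prP ratP; have idP := prime_ideal_ideal prP.
have /choice[lm lmP] : forall i, exists lm : CC * CC,
    lm != (0, 0) /\ P (lm.1 *: s i - lm.2 *: t i).
  (* A denominator vanishing modulo [P] corresponds to the pair (0, 1); otherwise the constant value
     c of s_i/t_i gives (1, c). *)
  move=> i; have [Pt|Pt] := pselect (P (t i)).
    exists (0, 1); split; first by rewrite xpair_eqE oner_eq0 andbF.
    by rewrite scale0r sub0r scale1r; apply: idealN.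
  have [r|c Pc] := ratP (s i) (t i) Pt.
    by rewrite pbracket_central subrr; apply: ideal0.
  exists (1, c); split; first by rewrite xpair_eqE oner_eq0.
  by rewrite scale1r.
exists (fun i => (lm i).1), (fun i => (lm i).2).
by split=> i; have [] := lmP i => //; rewrite -surjective_pairing.
Qed.

Lemma rational_locally_closed P :
  poisson_prime br P -> rational_pp br P -> locally_closed br P.
Proof.
move=> pP ratP; have [_ prP] := pP.
have [nullP|nullP] := pselect (residually_null br P).
  exact/maximal_locally_closed/(residually_null_rational prP nullP).
have [lam [mu [lm0 PJ]]] := rational_contains_pencil prP ratP.
exact: (poisson_prime_locally_closed lm0).
Qed.

End JacobianBracket.

(** * Classification of the Poisson primitive ideals and the Dixmier-Moeglin equivalence *)

Theorem theorem3p4 (n : nat) (hn : (3 <= n)%N)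
  (s t : 'I_(n - 2) -> {mpoly CC[n]})
  (ht : forall i, t i != 0)
  (hcop : forall i, coprimeR (s i) (t i))
  (hind : alg_indep_fracs s t) :
  (forall P : {mpoly CC[n]} -> Prop,
     poisson_primitive (pbracket s t) P <->
     (poisson_maximal (pbracket s t) P \/
      (proper_poisson (pbracket s t) P /\
       exists lam mu : 'I_(n - 2) -> CC,
         (forall i, (lam i, mu i) != (0, 0)) /\
         ~ gen_ideal (fun i => lam i *: s i - mu i *: t i) 1 /\
         minimal_prime P (gen_ideal (fun i => lam i *: s i - mu i *: t i)))))
  /\
  (forall P : {mpoly CC[n]} -> Prop,
     poisson_prime (pbracket s t) P ->
     (locally_closed (pbracket s t) P <-> poisson_primitive (pbracket s t) P) /\
     (poisson_primitive (pbracket s t) P <-> rational_pp (pbracket s t) P)).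
Proof.
have brD := pbracket_derivation s t hn; have brC := pbracketC s t hn.
have char0 := @mpoly_char0 n.
have primRat P : poisson_primitive (pbracket s t) P -> rational_pp (pbracket s t) P.
  exact: poisson_primitive_rational.
have lcPrim P : poisson_prime (pbracket s t) P ->
    locally_closed (pbracket s t) P -> poisson_primitive (pbracket s t) P.
  exact: locally_closed_primitive.
have ratLc P : poisson_prime (pbracket s t) P ->
    rational_pp (pbracket s t) P -> locally_closed (pbracket s t) P.
  exact: rational_locally_closed.
split=> P; last first.
  move=> pP; split; split; [exact: lcPrim|by move/primRat; apply: ratLc|
    exact: primRat|by move/(ratLc _ pP); apply: lcPrim].
split=> [primP|[maxP|[[pP nullP] [lam [mu [lm0 [_ [prP [JP _]]]]]]]]]; last 2 first.
- exact: poisson_maximal_primitive.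
- apply: lcPrim => //; apply: (poisson_prime_locally_closed hn lm0) => //.
  exact: (gen_ideal_subset _ (prime_ideal_ideal prP)).1 JP.
have [pP prP] := poisson_primitive_prime char0 brD primP.
have idP := prime_ideal_ideal prP.
have [nullP|nullP] := pselect (residually_null (pbracket s t) P).
  by left; apply: residually_null_primitive.
right; split=> //.
have [lam [mu [lm0 PJ]]] := rational_contains_pencil hn prP (primRat _ primP).
have JP := (gen_ideal_subset _ idP).2 PJ.
exists lam, mu; split=> //; split; first by move=> /JP; case: prP => _ [].
split=> //; split=> // Q prQ JQ QP.
apply: (poisson_prime_minimal hn lm0 (conj pP prP) nullP prQ _ QP).
exact: (gen_ideal_subset _ (prime_ideal_ideal prQ)).1 JQ.
Qed.
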